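(* Let $I$ be a regular icosahedron with edge length $\ell$ whose vertices are labeled $N,S,U_1,\dots,U_5,L_1,\dots,L_5$ as described in the context, and let $\mathcal{F}$ be the set of the ten triangles $F_S(i)=\triangle(S,U_i,L_i)$ and $F_N(i)=\triangle(N,U_i,L_{i-1})$, $i=1,\dots,5$ (with $L_0:=L_5$). Then every $F\in\mathcal{F}$ is an isosceles triangle with interior angles $36^\circ,36^\circ,108^\circ$. Moreover, for each $i$, the interior angle of $F_S(i)$ at the vertex $S$ equals $36^\circ$, and the interior angle of $F_N(i)$ at the vertex $N$ equals $36^\circ$.
   Context: $I$ is a regular icosahedron in $\mathbb{R}^3$ with edge length $\ell>0$ and center $O$. Its 12 vertices are labeled $V=\{N,S,U_1,\dots,U_5,L_1,\dots,L_5\}$, with indices taken modulo $5$. Here $N$ and $S$ are opposite vertices (the poles), and the line $NS$ is called the rotation axis. The vertices $U_1,\dots,U_5$ (upper ring) are the five neighbors of $N$, labeled cyclically so that $U_i$ is adjacent to $U_{i+1}$; the vertices $L_1,\dots,L_5$ (lower ring) are the five neighbors of $S$, labeled cyclically so that $L_i$ is adjacent to $L_{i+1}$; and the lower-ring vertices adjacent to $U_i$ are exactly $L_i$ and $L_{i-1}$. ''Adjacent'' means joined by an edge of the icosahedron. $\triangle(A,B,C)$ denotes the triangle with vertices $A,B,C$. *)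

(* Defs.v *)
From HB Require Import structures.
From mathcomp Require Import all_boot all_order all_algebra.
From mathcomp Require Import all_classical all_reals all_analysis.

Set Implicit Arguments.
Unset Strict Implicit.
Unset Printing Implicit Defensive.

Import Order.TTheory GRing.Theory Num.Theory.

Local Open Scope classical_set_scope.
Local Open Scope ring_scope.

Section Euclidean.
Context {R : realType}.
Local Notation point := 'rV[R]_3.
Implicit Types (a b c u v w x y : point) (K e F : set point).

Definition dot u v : R := \sum_i u 0 i * v 0 i.

(* The norm `|x| that the library puts on 'rV[R]_3 is the sup norm; distances
   here are Euclidean. *)
Definition enorm u : R := Num.sqrt (dot u u).
Definition edist x y : R := enorm (x - y).

(* Interior angle at a of the triangle with vertices a, b, c; the vertex of the
   angle comes first. *)
Definition angle a b c : R :=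
  acos (dot (b - a) (c - a) / (enorm (b - a) * enorm (c - a))).

Definition deg (t : R) : R := t * pi / 180.

Definition conv_hull (V : set point) : set point :=
  smallest (@convex_set R point) V.
Definition segment a b : set point := conv_hull [set a; b].

Definition noncollinear a b c : bool := free [:: b - a; c - a].
Definition noncoplanar a b c x : bool := free [:: b - a; c - a; x - a].

Definition convex_polyhedron K : Prop :=
  (exists2 V, finite_set V & K = conv_hull V) /\
  (exists a b c x, [/\ K a, K b, K c, K x & noncoplanar a b c x]).

(* For a polytope every face is exposed. Taking u = 0 gives the improper faces
   K and set0. *)
Definition face K F : Prop :=
  exists u (h : R),
    (forall x, K x -> dot u x <= h) /\ F = [set x | K x /\ dot u x = h].

Definition vertices K : set point := [set v | face K [set v]].

Definition adjacent K a b : Prop := a <> b /\ face K (segment a b).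

Definition edges K : set (set point) :=
  [set e | exists a b, adjacent K a b /\ e = segment a b].

(* A proper face of a solid lies in a plane, so it is two-dimensional as soon as
   it contains three noncollinear points. *)
Definition facets K : set (set point) :=
  [set F | [/\ face K F, F <> K &
    exists a b c, [/\ F a, F b, F c & noncollinear a b c]]].

Definition euclidean_isometry (g : point -> point) : Prop :=
  forall x y, edist (g x) (g y) = edist x y.

Definition symmetry K (g : point -> point) : Prop :=
  euclidean_isometry g /\ g @` K = K.

Definition flag K v e F : Prop :=
  [/\ vertices K v, edges K e, facets K F, e v & e `<=` F].

(* The symmetries act transitively on the flags. *)
Definition regular_polyhedron K : Prop :=
  convex_polyhedron K /\
  (forall v e F v' e' F', flag K v e F -> flag K v' e' F' ->
     exists g, [/\ symmetry K g, g v = v', g @` e = e' & g @` F = F']).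

Definition regular_icosahedron K : Prop :=
  regular_polyhedron K /\ (facets K #= `I_20)%card.

Definition edge_length K (ell : R) : Prop :=
  forall a b, adjacent K a b -> edist a b = ell.

Definition is_center K x : Prop :=
  forall v w, vertices K v -> vertices K w -> edist x v = edist x w.

Definition icosahedron_labeling K (O N S : point) (U L : 'Z_5 -> point) : Prop :=
  let labels := [:: N, S & codom U ++ codom L] in
  [/\ uniq labels /\ vertices K = [set` labels],
      N - O = O - S,
      (forall v, adjacent K N v <-> exists i, v = U i) /\
      (forall v, adjacent K S v <-> exists i, v = L i),
      (forall i, adjacent K (U i) (U (i + 1))) /\
      (forall i, adjacent K (L i) (L (i + 1))) &
      (forall i j, adjacent K (U i) (L j) <-> j = i \/ j = i - 1)].

Record triangle := Triangle { vtxA : point; vtxB : point; vtxC : point }.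

Definition nondegenerate_triangle (T : triangle) : bool :=
  noncollinear (vtxA T) (vtxB T) (vtxC T).

Definition isosceles (T : triangle) : Prop :=
  let: Triangle a b c := T in
  [\/ edist a b = edist a c, edist b a = edist b c | edist c a = edist c b].

Definition interior_angles (T : triangle) : seq R :=
  let: Triangle a b c := T in [:: angle a b c; angle b c a; angle c a b].

Definition triS S (U L : 'Z_5 -> point) (i : 'Z_5) : triangle :=
  Triangle S (U i) (L i).
Definition triN N (U L : 'Z_5 -> point) (i : 'Z_5) : triangle :=
  Triangle N (U i) (L (i - 1)).

Definition triangle_family N S (U L : 'Z_5 -> point) : set triangle :=
  range (triS S U L) `|` range (triN N U L).

Definition angleA (T : triangle) : R := angle (vtxA T) (vtxB T) (vtxC T).

End Euclidean.

(* Main.v *)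
Require Import Defs.
From HB Require Import structures.
From mathcomp Require Import all_boot all_order all_algebra.
From mathcomp Require Import all_classical all_reals all_analysis.
From mathcomp Require Import ring lra.

Set Implicit Arguments.
Unset Strict Implicit.
Unset Printing Implicit Defensive.

Import Order.TTheory GRing.Theory Num.Theory.

Local Open Scope classical_set_scope.
Local Open Scope ring_scope.

(** Put the origin at the centre, let k be the squared circumradius and c the
    scalar product of two adjacent vertices, so that ell ^+ 2 = 2 (k - c).

    The five neighbours p i of the pole n have the same norm, the same scalar
    product c with n, and the same scalar product c with their successor.  Hence
    p (i + 1) and p (i - 1) are mirror images of each other in the plane of n and
    p i ([reflection_sum]), which gives a linear recurrence around the ring
    ([ring_recurrence]); closing up after five steps forces k ^+ 2 = 5 c ^+ 2
    ([ring_ratio]).  So far nothing distinguishes the icosahedron (c > 0, the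
    ring is a pentagon) from the great icosahedron (c < 0, the ring is a
    pentagram), in which all the incidences of the labelling hold as well.

    Convexity decides.  A linear functional that exposes the edge from N to U i
    takes a value h at both ends and smaller values at all other vertices
    ([edge_functional]); being smaller at S = - N, it has h > 0.  The recurrence
    expresses the sum of two lower vertices as - 2 c / (k + c) times N + U i, so
    that - 2 c / (k + c) < 1, that is - k < 3 c ([supported_edge_ratio]).
    Together with k ^+ 2 = 5 c ^+ 2 this leaves only c > 0.

    Two vertices that are neither adjacent nor antipodal, such as S and U i, have
    scalar product - c, hence squared distance 2 (k + c), which is now
    (2 cos 36) ^+ 2 times ell ^+ 2 ([golden_ratio]).  Each triangle of the family
    therefore has two sides ell and a third side 2 cos 36 times ell, and the law
    of cosines gives its angles ([golden_angles]). *)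

Local Notation edist := Defs.edist.
Local Notation adjacent := Defs.adjacent.

(** * Scalar products in space *)

Section InnerProduct.
Context {R : realType}.
Implicit Types (a b c n m p u v w x y : 'rV[R]_3) (k t : R).

Lemma dotE u v :
  dot u v = u 0 0 * v 0 0 + u 0 1 * v 0 1 + u 0 2%:R * v 0 2%:R.
Proof.
rewrite /dot !big_ord_recl big_ord0 addr0 addrA.
by do ![congr (_ + _) | congr (_ * _)]; congr (_ 0 _); apply: val_inj.
Qed.

Lemma dotC u v : dot u v = dot v u.
Proof. by rewrite /dot; apply: eq_bigr => i _; rewrite mulrC. Qed.

Lemma dotDr u v w : dot u (v + w) = dot u v + dot u w.
Proof. by rewrite !dotE !mxE; ring. Qed.

Lemma dotNr u v : dot u (- v) = - dot u v.
Proof. by rewrite !dotE !mxE; ring. Qed.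

Lemma dotZr u k v : dot u (k *: v) = k * dot u v.
Proof. by rewrite !dotE !mxE; ring. Qed.

Lemma dotDl u v w : dot (v + w) u = dot v u + dot w u.
Proof. by rewrite dotC dotDr !(dotC u). Qed.

Lemma dotNl u v : dot (- v) u = - dot v u.
Proof. by rewrite dotC dotNr dotC. Qed.

Lemma dotZl u k v : dot (k *: v) u = k * dot v u.
Proof. by rewrite dotC dotZr dotC. Qed.

Definition dot_linear := (dotDl, dotDr, dotNl, dotNr, dotZl, dotZr).

Lemma dot_ge0 u : 0 <= dot u u.
Proof. by apply: sumr_ge0 => i _; rewrite -expr2 sqr_ge0. Qed.

Lemma dot_eq0 u : dot u u = 0 -> u = 0.
Proof.
move=> /eqP; rewrite /dot psumr_eq0; last by move=> i _; rewrite -expr2 sqr_ge0.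
move=> /allP u0; apply/rowP => i; rewrite mxE; apply/eqP.
by have := u0 i (mem_index_enum i); rewrite mulf_eq0 orbb.
Qed.

Lemma edistC x y : edist x y = edist y x.
Proof. by rewrite /edist /enorm !dot_linear; congr Num.sqrt; ring. Qed.

Lemma edist_sqr x y : edist x y ^+ 2 = dot (x - y) (x - y).
Proof. by rewrite sqr_sqrtr // dot_ge0. Qed.

(** The three vectors form a basis: the square of their determinant is their Gram
    determinant, which is nonzero since d is orthogonal to the other two.
    Cramer's rule then kills each coordinate of w. *)
Lemma orthogonal_frame_eq0 n m d w :
  dot d n = 0 -> dot d m = 0 -> d <> 0 -> dot n n * dot m m <> dot n m ^+ 2 ->
  dot w n = 0 -> dot w m = 0 -> dot w d = 0 -> w = 0.
Proof.
move=> dn dm d0 gram wn wm wd.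
pose det := n 0 0 * (m 0 1 * d 0 2%:R - m 0 2%:R * d 0 1)
          - n 0 1 * (m 0 0 * d 0 2%:R - m 0 2%:R * d 0 0)
          + n 0 2%:R * (m 0 0 * d 0 1 - m 0 1 * d 0 0).
have det2 : det ^+ 2 = dot d d * (dot n n * dot m m - dot n m ^+ 2)
    - dot n n * dot d m ^+ 2 - dot m m * dot d n ^+ 2
    + dot n m * dot d m * dot d n *+ 2.
  by rewrite /det !dotE; ring.
have det0 : det != 0.
  rewrite -sqrf_eq0 det2 dn dm expr0n !mulr0 !subr0 mul0rn addr0.
  rewrite mulf_neq0 // ?subr_eq0; last exact/eqP.
  by apply/eqP => /dot_eq0.
apply/rowP => j; rewrite mxE; apply: (mulfI det0); rewrite mulr0.
(* Multiplying by det reduces the claim to the three coordinates in turn. *)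
have cramer i : det * w 0 i = 0 -> i = j -> det * w 0 j = 0 by move=> + <-.
have /or3P[] : [|| j == 0, j == 1 | j == 2%:R].
  by case: j {cramer} => -[|[|[|]]].
- move=> /eqP/esym; apply: cramer.
  transitivity (dot w n * (m 0 1 * d 0 2%:R - m 0 2%:R * d 0 1)
    + dot w m * (d 0 1 * n 0 2%:R - d 0 2%:R * n 0 1)
    + dot w d * (n 0 1 * m 0 2%:R - n 0 2%:R * m 0 1)).
    by rewrite /det !dotE; ring.
  by rewrite wn wm wd !mul0r !addr0.
- move=> /eqP/esym; apply: cramer.
  transitivity (dot w n * (m 0 2%:R * d 0 0 - m 0 0 * d 0 2%:R)
    + dot w m * (d 0 2%:R * n 0 0 - d 0 0 * n 0 2%:R)
    + dot w d * (n 0 2%:R * m 0 0 - n 0 0 * m 0 2%:R)).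
    by rewrite /det !dotE; ring.
  by rewrite wn wm wd !mul0r !addr0.
- move=> /eqP/esym; apply: cramer.
  transitivity (dot w n * (m 0 0 * d 0 1 - m 0 1 * d 0 0)
    + dot w m * (d 0 0 * n 0 1 - d 0 1 * n 0 0)
    + dot w d * (n 0 0 * m 0 1 - n 0 1 * m 0 0)).
    by rewrite /det !dotE; ring.
  by rewrite wn wm wd !mul0r !addr0.
Qed.

End InnerProduct.

(** * Isosceles triangles in the golden ratio *)

Section GoldenTriangle.
Context {R : realType}.
Implicit Types (a b c u v : 'rV[R]_3) (ell : R).

Lemma deg36E : deg 36 = pi / 5 :> R.
Proof. by rewrite /deg; field. Qed.

Lemma deg_ge0_le_pi (t : R) : 0 <= t <= 180 -> 0 <= deg t <= pi.
Proof.
move=> /andP[t0 t180]; have pi0 := @pi_gt0 R.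
rewrite /deg divr_ge0 ?mulr_ge0 ?(ltW pi0) //= ler_pdivrMr; last by lra.
by rewrite mulrC ler_pM2l.
Qed.

Lemma cos36_gt0 : 0 < cos (deg 36) :> R.
Proof.
rewrite deg36E; apply: cos_gt0_pihalf.
by have := @pi_gt0 R => pi0; apply/andP; split; lra.
Qed.

(** With t = 36 degrees, 3 t and 2 t are supplementary, so sin (3 t) = sin (2 t);
    expand both and divide by sin t. *)
Lemma cos36_golden : 4 * cos (deg 36) ^+ 2 = 2 * cos (deg 36) + 1 :> R.
Proof.
have pi0 := @pi_gt0 R.
have s0 : 0 < sin (pi / 5 : R).
  by apply: sin_gt0_pi; apply/andP; split; lra.
have : sin (pi / 5 *+ 2 + pi / 5) = sin (pi / 5 *+ 2) :> R.
  rewrite -[RHS]opprK -sinN -sinDpi; congr sin.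
  by rewrite mulr2n; field.
rewrite sinD sin_mulr2n cos_mulr2n -deg36E -/(deg 36).
rewrite -deg36E in s0.
set x := cos _; set s := sin _ => e.
rewrite !mulr2n in e; apply: (mulIf (lt0r_neq0 s0)); rewrite -[sin _]/s; lra.
Qed.

Lemma cos108 : cos (deg 108) = 1 - 2 * cos (deg 36) ^+ 2 :> R.
Proof.
have -> : deg 108 = - (deg 36 *+ 2) + pi :> R by rewrite /deg mulr2n; field.
by rewrite cosDpi cosN cos_mulr2n mulr2n; ring.
Qed.

Lemma angle_law_of_cosines a b c :
  angle a b c = acos ((edist a b ^+ 2 + edist a c ^+ 2 - edist b c ^+ 2)
                      / (2 * edist a b * edist a c)).
Proof.
rewrite /angle -/(edist b a) -/(edist c a) (edistC b) (edistC c) -mulrA.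
rewrite [in RHS]invfM [in RHS]mulrA; congr (acos (_ / _)).
rewrite !edist_sqr !dot_linear (dotC b a) (dotC c a) (dotC c b).
by field.
Qed.

Lemma free_gram u v : dot u v ^+ 2 <> dot u u * dot v v -> free [:: u; v].
Proof.
move=> gram; rewrite free_cons span_seq1 seq1_free; apply/andP; split.
  by apply/vlineP => -[k uE]; apply: gram; rewrite uE !dot_linear; ring.
by apply/eqP => v0; apply: gram; rewrite v0 !dotE !mxE; ring.
Qed.

(** By Heron's formula the two sides differ by 16 times the squared area.  This
    form is symmetric in the three vertices, unlike [noncollinear], so that it
    applies whichever vertex is named first. *)
Lemma heron_noncollinear a b c :
  edist a b ^+ 4 + edist b c ^+ 4 + edist c a ^+ 4 <>
    2 * (edist a b ^+ 2 * edist b c ^+ 2 + edist b c ^+ 2 * edist c a ^+ 2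
         + edist c a ^+ 2 * edist a b ^+ 2) ->
  noncollinear a b c.
Proof.
move=> area; apply: free_gram => gram; apply: area.
rewrite !(exprM _ 2 2) !edist_sqr.
move: gram; rewrite !dot_linear (dotC b a) (dotC c a) (dotC c b).
by lra.
Qed.

(** Half the base over the leg is cos 36, which is the cosine of a base angle; the
    angle at the apex c has cosine 1 - 2 cos 36 ^+ 2 = cos 108. *)
Lemma golden_angles a b c ell : 0 < ell ->
  edist c a = ell -> edist c b = ell -> edist a b = 2 * cos (deg 36) * ell ->
  [/\ angle a b c = deg 36, angle b c a = deg 36 & angle c a b = deg 108].
Proof.
move=> ell0 ca cb ab; have x0 := cos36_gt0.
have ell_neq0 := lt0r_neq0 ell0; have x_neq0 := lt0r_neq0 x0.
have acos36 : acos (cos (deg 36)) = deg 36 :> R.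
  by apply: cosK; rewrite in_itv /=; apply: deg_ge0_le_pi; lra.
split; rewrite angle_law_of_cosines.
- rewrite (edistC a c) (edistC b c) ca cb ab -[RHS]acos36; congr acos.
  by field; rewrite ell_neq0.
- rewrite (edistC b c) (edistC b a) ca cb ab -[RHS]acos36; congr acos.
  by field; rewrite ell_neq0.
rewrite ca cb ab -[RHS]cosK; last first.
  by rewrite in_itv /=; apply: deg_ge0_le_pi; lra.
by congr acos; rewrite cos108; field.
Qed.

(** The second conclusion serves triangles whose apex is listed second. *)
Lemma golden_noncollinear a b c ell : 0 < ell ->
  edist c a = ell -> edist c b = ell -> edist a b = 2 * cos (deg 36) * ell ->
  noncollinear a b c /\ noncollinear b c a.
Proof.
move=> ell0 ca cb ab; have x0 := cos36_gt0; have xx := cos36_golden.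
have l4 : ell ^+ 4 != 0 by rewrite expf_neq0 // lt0r_neq0.
split; apply: heron_noncollinear; rewrite (edistC b c) ca cb ab.
all: move: (cos _) x0 xx => x x0 xx e.
all: have /eqP : ell ^+ 4 * (4 * x ^+ 2 * (4 * x ^+ 2 - 4)) = 0
       by move: e => /eqP; rewrite -subr_eq0 => /eqP <-; ring.
all: by rewrite mulf_eq0 (negbTE l4) /= mulf_eq0 => /orP[] /eqP ?; nra.
Qed.
End GoldenTriangle.

(** * Linear functionals exposing an edge *)

Section SupportingFunctional.
Context {R : realType}.
Implicit Types (a b n p u v : 'rV[R]_3) (K : set 'rV[R]_3) (h : R).

(** An open half-space is convex, hence contains the hull of any two of its
    points. *)
Lemma segment_lt u h a b v :
  dot u a < h -> dot u b < h -> segment a b v -> dot u v < h.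
Proof.
move=> ua ub /(_ [set w | dot u w < h]); apply; split; last first.
  by move=> w /= [] ->.
have lt_conv (x y : 'rV[R]_3) (t : R) : dot u x < h -> dot u y < h ->
    0 < t -> t < 1 -> dot u (t *: x + (1 - t) *: y) < h.
  by rewrite dotDr !dotZr; nra.
apply/convex_setW => x y /[!inE] /= ux uy t t0 t1.
by apply: mem_set; exact: (lt_conv x y t%:num).
Qed.

Lemma segment_end1 a b : segment a b a.
Proof. by apply: sub_gen_smallest; left. Qed.

Lemma segment_end2 a b : segment a b b.
Proof. by apply: sub_gen_smallest; right. Qed.

Lemma vertex_in K v : vertices K v -> K v.
Proof. by move=> [u [h [_ /seteqP[/(_ v erefl)[]]]]]. Qed.

(** The functional exposing v is strictly below its maximum at a and at b, hence
    on the whole segment. *)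
Lemma vertex_notin_segment K a b v :
  K a -> K b -> vertices K v -> v <> a -> v <> b -> ~ segment a b v.
Proof.
move=> Ka Kb [u [h [Kh vE]]] va vb.
have uv : dot u v = h by have /seteqP[/(_ v erefl)[]] := vE.
have lt_h x : K x -> v <> x -> dot u x < h.
  move=> Kx vx; rewrite lt_neqAle Kh // andbT; apply/eqP => ux; apply: vx.
  by have /seteqP[_ /(_ x (conj Kx ux)) ->] := vE.
by move=> /(segment_lt (lt_h a Ka va) (lt_h b Kb vb)); rewrite uv ltxx.
Qed.

(** The contact set of the functional exposing an edge is the edge itself, and the
    edge contains no third vertex; hence the strict inequality. *)
Lemma edge_functional K a b : adjacent K a b ->
  exists u h, [/\ dot u a = h, dot u b = h &
    forall v, vertices K v -> v <> a -> v <> b -> dot u v < h].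
Proof.
move=> [_ [u [h [Kh abE]]]]; have /seteqP[abK Kab] := abE.
have [Ka ua] := abK a (@segment_end1 a b).
have [Kb ub] := abK b (@segment_end2 a b).
exists u, h; split=> // v vK va vb; have Kv := vertex_in vK.
rewrite lt_neqAle Kh // andbT; apply/eqP => uv.
exact: (vertex_notin_segment Ka Kb vK va vb (Kab v (conj Kv uv))).
Qed.

End SupportingFunctional.

(** * Rings of five vertices around a pole *)

Section Pentagon.
Context {R : realType}.
Implicit Types (n m p u : 'rV[R]_3) (k c : R).

(** Two distinct vectors of equal norm with the same scalar products s and t with
    n and m are mirror images in the plane of n and m.  Their sum lies in that
    plane, and its coordinates there are read off from its scalar products with n
    and m.  The determinant k ^+ 2 - c ^+ 2 is kept on the left to avoid
    division. *)
Lemma reflection_sum n m p p' k c s t :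
  dot n n = k -> dot m m = k -> dot n m = c -> k ^+ 2 <> c ^+ 2 ->
  dot p p = dot p' p' -> p <> p' ->
  dot n p = s -> dot n p' = s -> dot m p = t -> dot m p' = t ->
  (k ^+ 2 - c ^+ 2) *: (p + p')
    = (2 * (s * k - t * c)) *: n + (2 * (t * k - s * c)) *: m.
Proof.
move=> nn mm nm kc pp' ne np np' mp mp'.
apply/eqP; rewrite -subr_eq0; apply/eqP.
apply: (@orthogonal_frame_eq0 _ n m (p - p')).
- by rewrite !dot_linear !(dotC _ n) np np' subrr.
- by rewrite !dot_linear !(dotC _ m) mp mp' subrr.
- by move=> /eqP; rewrite subr_eq0 => /eqP.
- by rewrite nn mm nm.
- by rewrite !dot_linear !(dotC _ n) np np' nn nm; ring.
- by rewrite !dot_linear !(dotC _ m) (dotC m n) mp mp' mm nm; ring.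
by rewrite !dot_linear np np' mp mp' pp' (dotC p' p); ring.
Qed.

(** The two ring neighbours of p i make the scalar product c both with n and with
    p i, so this is [reflection_sum] with s = t = c, divided by k - c. *)
Lemma ring_recurrence n (p : 'Z_5 -> 'rV[R]_3) k c i :
  dot n n = k -> (forall i, dot (p i) (p i) = k) ->
  (forall i, dot n (p i) = c) -> (forall i, dot (p i) (p (i + 1)) = c) ->
  injective p -> k ^+ 2 <> c ^+ 2 ->
  (k + c) *: (p (i + 1) + p (i - 1)) = (2 * c) *: (n + p i).
Proof.
move=> nn pp np pS pI kc.
have kBc : k - c != 0.
  by rewrite subr_eq0; apply/eqP => kE; apply: kc; rewrite kE.
apply: (scalerI kBc); rewrite !scalerA -subr_sqr.
rewrite (reflection_sum nn (pp i) (np i) kc _ _ (np _) (np _) (pS _)).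
- by rewrite scalerDr; congr (_ *: _ + _ *: _); ring.
- by rewrite !pp.
- by move=> /pI; case: i => -[|[|[|[|[|]]]]].
by rewrite dotC -{2}(subrK 1 i) pS.
Qed.

(** Taking scalar products of the recurrence with p (i - 1) and with p (i + 2)
    gives two equations for the scalar product of a diagonal of the ring: the
    second says that it is - c, and then the first is the claim. *)
Lemma ring_ratio n (p : 'Z_5 -> 'rV[R]_3) k c :
  dot n n = k -> (forall i, dot (p i) (p i) = k) ->
  (forall i, dot n (p i) = c) -> (forall i, dot (p i) (p (i + 1)) = c) ->
  injective p -> k ^+ 2 <> c ^+ 2 ->
  k ^+ 2 = 5 * c ^+ 2.
Proof.
move=> nn pp np pS pI kc.
have kBc : k - c != 0.
  by rewrite subr_eq0; apply/eqP => kE; apply: kc; rewrite kE.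
have kDc : k + c != 0.
  by rewrite addr_eq0; apply/eqP => kE; apply: kc; rewrite kE sqrrN.
have E i := ring_recurrence i nn pp np pS pI kc.
have diag i : (k + c) * (k + dot (p (i - 1)) (p (i + 1))) = 4 * c ^+ 2.
  have := congr1 (dot (p (i - 1))) (E i).
  rewrite !dotZr !dotDr pp (dotC _ n) np -{4}(subrK 1 i) pS => e.
  by rewrite [k + dot _ _]addrC e; ring.
have D1 : (k + c) * (k + dot (p 0) (p 2%:R)) = 4 * c ^+ 2.
  by have := diag 1; rewrite subrr (_ : 1 + 1 = 2%:R).
have diag0 : dot (p 0) (p 2%:R) = - c.
  have D3 : (k + c) * (k + dot (p 2%:R) (p (-1))) = 4 * c ^+ 2.
    have := diag 3%:R; rewrite (_ : 3%:R - 1 = 2%:R); last exact: val_inj.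
    by rewrite (_ : 3%:R + 1 = -1); last exact: val_inj.
  have D13 : dot (p 2%:R) (p (-1)) = dot (p 0) (p 2%:R).
    by apply: (addrI k); apply: (mulfI kDc); rewrite D1 D3.
  (* The vertices - 1 and 2 are two steps apart modulo 5, so D13 turns this
     recurrence into an equation for the diagonal from 0 to 2 alone. *)
  have := congr1 (dot (p 2%:R)) (E 0); rewrite add0r sub0r.
  rewrite !dotZr !dotDr D13 !(dotC _ n) np !(dotC (p 2%:R)).
  rewrite (_ : dot (p 1) _ = c); last by rewrite -(pS 1); congr (dot _ (p _)).
  move=> e; apply/eqP; rewrite -addr_eq0 addrC; apply/eqP.
  by apply: (mulfI kBc); rewrite mulr0; move: e; lra.
by move: D1; rewrite diag0; lra.
Qed.

End Pentagon.

(** * Excluding the great icosahedron *)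

Section LabelledIcosahedron.
Context {R : realType}.
Implicit Types (a b n u O : 'rV[R]_3) (k c h : R).

Lemma edist_sqr_centred O a b :
  edist a b ^+ 2 =
    dot (a - O) (a - O) + dot (b - O) (b - O) - 2 * dot (a - O) (b - O).
Proof. by rewrite edist_sqr !dotE !mxE; ring. Qed.

(** Since low i and low (i - 1) are both adjacent to up i, their sum is a multiple
    of up i - n, on which u vanishes.  Adding the recurrences at i and at i - 1
    in the lower ring therefore gives the value of u at
    low (i + 1) + low (i - 2) as - 4 c h / (k + c), which has to be less than
    2 h with h > 0. *)
Lemma supported_edge_ratio n (up low : 'Z_5 -> 'rV[R]_3) k c i u h :
  dot n n = k -> (forall j, dot (up j) (up j) = k) ->
  (forall j, dot (low j) (low j) = k) ->
  dot n (up i) = c -> (forall j, dot (- n) (low j) = c) ->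
  (forall j, dot (low j) (low (j + 1)) = c) ->
  dot (up i) (low i) = c -> dot (up i) (low (i - 1)) = c ->
  injective low -> k ^+ 2 <> c ^+ 2 -> 0 < k + c ->
  dot u n = h -> dot u (up i) = h -> dot u (- n) < h ->
  (forall j, dot u (low j) < h) ->
  - k < 3 * c.
Proof.
move=> nn uu ll nu nl lS ul ul' lI kc kDc un uup uS ulow.
have k2Bc2 : k ^+ 2 - c ^+ 2 != 0 by rewrite subr_eq0; apply/eqP.
have nn' : dot (- n) (- n) = k by rewrite !dot_linear opprK.
have nl' j : dot n (low j) = - c by rewrite -(nl j) dotNl opprK.
have low_pair : dot u (low i + low (i - 1)) = 0.
  apply: (mulfI k2Bc2).
  rewrite -dotZr (reflection_sum nn (uu i) nu kc _ _ (nl' _) (nl' _) ul ul').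
  - by rewrite !dot_linear un uup; ring.
  - by rewrite !ll.
  - by move=> /lI; case: i {nu ul ul' uup} => -[|[|[|[|[|]]]]].
have E j := congr1 (dot u) (ring_recurrence j nn' ll nl lS lI kc).
have := E i; have := E (i - 1); have := ulow (i + 1); have := ulow (i - 1 - 1).
move: low_pair uS; rewrite subrK !dot_linear un.
move: (dot u (low (i + 1))) (dot u (low (i - 1 - 1))) => A B.
move: (dot u (low i)) (dot u (low (i - 1))) => C D CD h0 ltB ltA EB EA.
have AB : (k + c) * (A + B) = - (4 * c * h).
  have DE : D = - C by lra.
  by move: EB EA; rewrite DE; lra.
have ltAB : (k + c) * (A + B) < (k + c) * (2 * h) by rewrite ltr_pM2l //; lra.
have : 0 < h * (k + 3 * c) by move: ltAB; rewrite AB; lra.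
by rewrite pmulr_rgt0; lra.
Qed.

(** Squaring shows that cos 36 * k = (cos 36 + 1) * c is a form of
    k = sqrt 5 * c, because (cos 36 + 1) ^+ 2 = 5 cos 36 ^+ 2. *)
Lemma golden_ratio k c : 0 < k -> 0 < c -> k ^+ 2 = 5 * c ^+ 2 ->
  k + c = (2 * cos (deg 36)) ^+ 2 * (k - c).
Proof.
move=> k0 c0 kc; have x0 := @cos36_gt0 R; have := @cos36_golden R.
move: (cos _) x0 => x x0 xx.
have : (x * k) ^+ 2 == ((x + 1) * c) ^+ 2.
  rewrite !exprMn kc; apply/eqP.
  have -> : (x + 1) ^+ 2 = 5 * x ^+ 2 by lra.
  by ring.
rewrite eqrXn2 ?mulr_ge0 //; try lra.
move=> /eqP e; rewrite exprMn (_ : 2 ^+ 2 = 4); last by ring.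
by rewrite xx; lra.
Qed.

End LabelledIcosahedron.

(** * The triangles of the icosahedron *)

Theorem theorem1 (R : realType) (ell : R) (I : set 'rV[R]_3)
    (O N S : 'rV[R]_3) (U L : 'Z_5 -> 'rV[R]_3)
    (hell : 0 < ell) (hI : regular_icosahedron I) (hlen : edge_length I ell)
    (hO : is_center I O) (hV : icosahedron_labeling I O N S U L) :
  (forall T, triangle_family N S U L T ->
     [/\ nondegenerate_triangle T, isosceles T &
         perm_eq (interior_angles T) [:: deg 36; deg 36; deg 108]]) /\
  (forall i : 'Z_5,
     angleA (triS S U L i) = deg 36 /\ angleA (triN N U L i) = deg 36).
Proof.
have [[luniq vE] NOS [adjN adjS] [adjU adjL] adjUL] := hV.
have vtx v : v \in [:: N, S & codom U ++ codom L] -> vertices I v by rewrite vE.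
have vN : vertices I N by apply: vtx; rewrite !inE eqxx.
have vS : vertices I S by apply: vtx; rewrite !inE eqxx orbT.
have vU i : vertices I (U i).
  by apply: vtx; rewrite !in_cons mem_cat codom_f !orbT.
have vL i : vertices I (L i).
  by apply: vtx; rewrite !in_cons mem_cat codom_f !orbT.
move: luniq => /= /and3P[]; rewrite in_cons mem_cat !negb_or.
move=> /and3P[/eqP NS _ NL]; rewrite mem_cat negb_or => /andP[SU _].
rewrite cat_uniq => /and3P[/injectiveP UI UL /injectiveP LI].
have neNL i : L i <> N by move=> e; move: NL; rewrite -e codom_f.
have neSU i : S <> U i by move=> e; move: SU; rewrite e codom_f.
have neUL i j : L j <> U i.
  by move=> e; move/hasPn: UL => /(_ (L j) (codom_f _ _)); rewrite e /= codom_f.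
have SO : S - O = - (N - O) by rewrite NOS opprB.
pose k := dot (N - O) (N - O); pose c := k - ell ^+ 2 / 2.
have cE : c = k - ell ^+ 2 / 2 by [].
have norm v : vertices I v -> dot (v - O) (v - O) = k.
  by move=> vv; rewrite /k -!edist_sqr !(edistC _ O) (hO v N).
have adj a b : vertices I a -> vertices I b -> adjacent I a b ->
    dot (a - O) (b - O) = c.
  move=> va vb /hlen ab; have := edist_sqr_centred O a b.
  by rewrite ab !norm //; lra.
have adjNU i : adjacent I N (U i) by apply/adjN; exists i.
have adjSL i : adjacent I S (L i) by apply/adjS; exists i.
have adjULi i : adjacent I (U i) (L i) by apply/adjUL; left.
have adjULi1 i : adjacent I (U i) (L (i - 1)) by apply/adjUL; right.
have ell2_gt0 : 0 < ell ^+ 2 by rewrite exprn_gt0.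
have centredI (p : 'Z_5 -> 'rV[R]_3) :
    injective p -> injective (fun i => p i - O).
  by move=> pI i j /addIr /pI.
have k_gt0 : 0 < k.
  rewrite lt_neqAle dot_ge0 andbT eq_sym; apply/eqP => /dot_eq0 n0.
  by apply: NS; move: SO; rewrite n0 oppr0 => /subr0_eq ->; apply: subr0_eq.
(* 2 (k + c) is the squared distance of the distinct points S and U 0. *)
have kDc : 0 < k + c.
  have : edist S (U 0) ^+ 2 = 2 * (k + c).
    by rewrite (edist_sqr_centred O) !norm // SO dotNl (adj N (U 0)) //; ring.
  rewrite -(pmulr_rgt0 _ (ltr0Sn R 1)) => <-.
  rewrite lt_neqAle sqr_ge0 andbT eq_sym; apply/eqP.
  by rewrite edist_sqr => /dot_eq0/subr0_eq/neSU.
have kc : k ^+ 2 <> c ^+ 2.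
  move=> /eqP; rewrite -subr_eq0 subr_sqr mulf_eq0 => /orP[]/eqP; lra.
have k2 : k ^+ 2 = 5 * c ^+ 2.
  apply: (@ring_ratio _ (N - O) (fun i => U i - O)) => //.
  - by move=> i; exact: norm.
  - by move=> i; exact: adj.
  - by move=> i; exact: adj.
  - exact: centredI.
(* This is the step that excludes the great icosahedron. *)
have c3 : - k < 3 * c.
  have [u [h [uN uU ult]]] := edge_functional (adjNU 0).
  apply: (@supported_edge_ratio _ (N - O) (fun i => U i - O) (fun i => L i - O)
    k c 0 u (h - dot u O)) => //.
  - by move=> j; exact: norm.
  - by move=> j; exact: norm.
  - exact: adj.
  - by move=> j; rewrite -SO; exact: adj.
  - by move=> j; exact: adj.
  - exact: adj.
  - exact: adj.
  - exact: centredI.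
  - by rewrite !dot_linear uN.
  - by rewrite !dot_linear uU.
  - rewrite -SO !dot_linear ltrD2r; apply: ult => //; exact/nesym.
  - by move=> j; rewrite !dot_linear ltrD2r; exact: ult.
(* Otherwise k > - 3 c >= 0 and k ^+ 2 > 9 c ^+ 2. *)
have c_gt0 : 0 < c by nra.
have long a b : vertices I a -> vertices I b -> dot (a - O) (b - O) = - c ->
    edist a b = 2 * cos (deg 36) * ell.
  move=> va vb ab; have x0 := @cos36_gt0 R.
  suff : edist a b ^+ 2 == (2 * cos (deg 36) * ell) ^+ 2.
    by rewrite eqrXn2 ?sqrtr_ge0 ?mulr_ge0 ?(ltW hell) ?(ltW x0) // => /eqP.
  rewrite (edist_sqr_centred O) !norm // ab [in X in _ == X]exprMn.
  have := golden_ratio k_gt0 c_gt0 k2.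
  rewrite (_ : k - c = ell ^+ 2 / 2) => [e|]; last by lra.
  by apply/eqP; lra.
have SUlong i : edist S (U i) = 2 * cos (deg 36) * ell.
  by apply: long => //; rewrite SO dotNl (adj N).
have LNlong i : edist (L i) N = 2 * cos (deg 36) * ell.
  by apply: long => //; rewrite dotC -[N - O]opprK -SO dotNl (adj S).
have LS i : edist (L i) S = ell by rewrite edistC hlen.
have LU i : edist (L i) (U i) = ell by rewrite edistC hlen.
have UL1 i : edist (U i) (L (i - 1)) = ell by rewrite hlen.
have UN i : edist (U i) N = ell by rewrite edistC hlen.
have angS i := golden_angles hell (LS i) (LU i) (SUlong i).
have angN i := golden_angles hell (UL1 i) (UN i) (LNlong (i - 1)).
split; last first.
  by move=> i; have [? _ _] := angS i; have [_ ? _] := angN i.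
move=> T [] [i _ <-].
- have [a1 a2 a3] := angS i; split.
  + by have [] := golden_noncollinear hell (LS i) (LU i) (SUlong i).
  + by apply: Or33; rewrite LS LU.
  + by rewrite /= a1 a2 a3.
- have [a1 a2 a3] := angN i; split.
  + by have [] := golden_noncollinear hell (UL1 i) (UN i) (LNlong (i - 1)).
  + by apply: Or32; rewrite UL1 UN.
  + by rewrite /= a1 a2 a3 perm_cons; exact: (permEl (perm_catC [:: _] [:: _])).
Qed.
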